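(* Consider $p$ coupled harmonic oscillators (in $\mathbb{R}^2$) described, for $i=1,\ldots,p$, by $$\dot{x}_i=y_i,\qquad \dot{y}_i=-x_i+\sum_{j=1}^p\gamma_{ij}(y_j-y_i),$$ with $x_i,y_i\in\mathbb{R}$. For every connected interconnection $[\gamma_{ij}]\in\mathbb{R}^{p\times p}$ the oscillators synchronize; that is, for all initial conditions the solutions $(x_i(\cdot),y_i(\cdot))$, $i=1,\ldots,p$, synchronize.
   Context: A matrix $\Gamma=[\gamma_{ij}]\in\mathbb{R}^{p\times p}$ is an interconnection if $\gamma_{ij}\geq 0$ for $i\neq j$ and $\gamma_{ii}=-\sum_{j\neq i}\gamma_{ij}$. Its graph is the directed graph with nodes $n_1,\ldots,n_p$ in which $(n_i,n_j)$ is an edge iff $\gamma_{ij}>0$. $\Gamma$ is connected if this graph has a node to which there exists a (directed) path from every other node. Maps $\xi_i:\mathbb{R}_{\geq 0}\to\mathbb{R}^n$, $i=1,\ldots,p$, synchronize if there is a map $\bar\xi:\mathbb{R}_{\geq0}\to\mathbb{R}^n$ with $|\xi_i(t)-\bar\xi(t)|\to0$ as $t\to\infty$ for all $i$. *)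

(* Defs.v *)
From mathcomp Require Import all_boot all_order all_algebra.
From mathcomp Require Import all_classical all_reals all_analysis.
Set Implicit Arguments.
Unset Strict Implicit.
Unset Printing Implicit Defensive.
Import Order.TTheory GRing.Theory Num.Theory.
Import numFieldNormedType.Exports.
Local Open Scope classical_set_scope.
Local Open Scope ring_scope.

Definition interconnection (R : realType) (p : nat) (G : 'M[R]_p) : Prop :=
  (forall i j : 'I_p, i != j -> 0 <= G i j) /\
  (forall i : 'I_p, G i i = - \sum_(j < p | j != i) G i j).

Definition interconnection_graph (R : realType) (p : nat) (G : 'M[R]_p) : rel 'I_p :=
  fun i j => 0 < G i j.

(* No separate assumption 0 < p is needed: a connected graph has a node. *)
Definition connected_interconnection (R : realType) (p : nat) (G : 'M[R]_p)
    : Prop :=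
  exists i : 'I_p, forall j : 'I_p, j != i -> connect (interconnection_graph G) j i.

(* The library norm on matrices is the sup norm, not the Euclidean one. *)
Definition euclid_norm (R : realType) (n : nat) (v : 'rV[R]_n) : R :=
  Num.sqrt (\sum_(k < n) v 0 k ^+ 2).

(* Maps on R_{>=0} are represented by total maps on R; their values at
   negative times are irrelevant to a limit at +oo. *)
Definition synchronize (R : realType) (p n : nat) (xi : 'I_p -> R -> 'rV[R]_n)
    : Prop :=
  exists xibar : R -> 'rV[R]_n, forall i : 'I_p,
    euclid_norm (xi i t - xibar t) @[t --> +oo] --> (0 : R).

(* Solution on [0, +oo[ of the coupled oscillators from (x0, y0): continuous
   on the closed half-line and satisfying the equations at every t > 0, so
   that nothing is required of the values at negative times. *)
Definition oscillators_solution (R : realType) (p : nat) (G : 'M[R]_p)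
    (x0 y0 : 'I_p -> R) (x y : 'I_p -> R -> R) : Prop :=
  forall i : 'I_p,
  [/\ x i 0 = x0 i /\ y i 0 = y0 i,
      {within `[0, +oo[, continuous (x i)},
      {within `[0, +oo[, continuous (y i)},
      forall t : R, 0 < t -> is_derive t (1 : R) (x i) (y i t) &
      forall t : R, 0 < t ->
        is_derive t (1 : R) (y i)
          (- x i t + \sum_(j < p) G i j * (y j t - y i t))].

Definition oscillator_state (R : realType) (p : nat) (x y : 'I_p -> R -> R)
    (i : 'I_p) (t : R) : 'rV[R]_2 :=
  \row_(k < 2) (if k == 0 then x i t else y i t).

(* Main.v *)
Require Import Defs.
From mathcomp Require Import all_boot all_order all_algebra.
From mathcomp Require Import all_classical all_reals all_analysis.
From mathcomp Require Import complex ring lra.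
Set Implicit Arguments.
Unset Strict Implicit.
Unset Printing Implicit Defensive.
Import Order.TTheory GRing.Theory Num.Theory.
Import numFieldNormedType.Exports.
Local Open Scope classical_set_scope.
Local Open Scope ring_scope.

(* For a row vector w, complex in general, write w.y for the sum of w_j y_j; then
   (w.y)' = - w.x + (w G).y.  If u = w (G - z) with Re z < 0 and both u.x and u.y
   tend to 0, then w.x is a damped oscillator driven by the vanishing input u.y,
   so w.x and w.y tend to 0 as well.  The maximum principle on the graph shows
   that ker G consists of the constant vectors, that ker G^2 = ker G, and that
   every nonzero eigenvalue of G has negative real part.  By Cayley-Hamilton,
   G B = 0, where B is a product of factors G - z with Re z < 0; so the columns
   of B are constant and w B = 0 as soon as the entries of w sum to 0.  Peeling
   the factors of B off one by one gives w.x, w.y -> 0 for such w, in particular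
   for the difference of two coordinates. *)

(** * Decay of dissipative scalar functions and of damped oscillators *)

Lemma cvg0_pinftyP (R : realType) (u : R -> R) :
  u t @[t --> +oo] --> (0 : R) <->
  forall e : R, 0 < e -> exists T : R, forall t, T < t -> `|u t| < e.
Proof.
split=> [u0 e e0|H].
  by have [T [_ uT]] := cvgr0_norm_lt u u0 e e0; exists T.
apply/cvgr0Pnorm_lt => e /H[T uT].
by exists T; split => //; exact: num_real.
Qed.

(** Gronwall argument: once [F] stays below [c * (e / 2)], the function
    [expR (c * s) * (E s - e / 2)] is nonincreasing, so [E] exceeds [e / 2] by at most a decaying
    exponential. *)
Lemma cvg0_of_dissipation (R : realType) (E dE F : R -> R) (c : R) :
  0 < c ->
  (forall t, 0 <= E t) ->
  (forall t : R, 0 < t -> is_derive t (1 : R) E (dE t)) ->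
  (forall t, 0 < t -> dE t <= - c * E t + F t) ->
  F t @[t --> +oo] --> (0 : R) ->
  E t @[t --> +oo] --> (0 : R).
Proof.
move=> c0 E0 dEP dEle /cvg0_pinftyP F0; apply/cvg0_pinftyP => e e0.
have [|T FT] := F0 (c * (e / 2)).
  by rewrite mulr_gt0// divr_gt0.
(* Strictly positive as well as beyond [T], since the derivative of [E] is known at positive times
   only. *)
set T1 := Num.max T 0 + 1.
have T1T : T < T1 by rewrite /T1 ltr_pwDr// le_max lexx.
have T10 : 0 < T1 by rewrite /T1 ltr_pwDr// le_max lexx orbT.
pose h s := expR (c * s) * (E s - e / 2).
pose dh s := expR (c * s) * (c * (E s - e / 2) + dE s).
have hP (s : R) : 0 < s -> is_derive s (1 : R) h (dh s).
  move=> s0; have := dEP _ s0 => ?.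
  apply: is_derive_eq; rewrite /dh /GRing.scale /=.
  ring.
have hle t : T1 < t -> h t <= h T1.
  move=> Tt.
  have hd (x : R) : x \in `]T1, t[ -> is_derive x (1 : R) h (dh x).
    by rewrite in_itv/= => /andP[T1x _]; apply: hP; exact: lt_trans T1x.
  have [|x xi] := MVT Tt hd.
    apply: derivable_within_continuous => x.
    rewrite in_itv/= => /andP[T1x _].
    by have /@ex_derive := hP _ (lt_le_trans T10 T1x).
  move=> hE; rewrite -subr_le0 hE.
  apply: mulr_le0_ge0; last by rewrite subr_ge0 ltW.
  move: xi; rewrite in_itv/= => /andP[T1x _].
  apply: mulr_ge0_le0; first exact: expR_ge0.
  have := dEle _ (lt_trans T10 T1x); have := FT _ (lt_trans T1T T1x).
  rewrite /= => /ltr_normlP[_ ? ?]; nra.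
pose K := expR (c * T1) * E T1.
have K0 : 0 <= K by rewrite mulr_ge0// expR_ge0.
have /cvg0_pinftyP/(_ (e / 2)) : K * expR (- (c * t)) @[t --> +oo] --> (0 : R).
  rewrite -[X in _ --> X](mulr0 K); apply: cvgMl_tmp.
  apply: (cvg_comp (fun t : R => c * t) (fun t => expR (- t))) (@cvgr_expR R).
  exact: gt0_cvgMry.
case=> [|S KS]; first by rewrite divr_gt0.
exists (Num.max S T1) => t; rewrite gt_max => /andP[St T1t].
rewrite ger0_norm//.
have := KS _ St; rewrite /= => /ltr_normlP[_ Kt].
have ht := hle _ T1t.
have p := expR_gt0 (- (c * t)).
have eE : expR (c * t) * expR (- (c * t)) = 1 by rewrite -expRD subrr expR0.
have : h t * expR (- (c * t)) <= K * expR (- (c * t)).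
  rewrite ler_pM2r//; apply: le_trans ht _.
  by rewrite /h /K ler_pM2l ?expR_gt0//; lra.
have -> : h t * expR (- (c * t)) = E t - e / 2.
  by rewrite /h mulrAC eE mul1r.
lra.
Qed.

(* The Lyapunov function [E] is the energy plus a small multiple of the cross
   term [X Y], since the energy alone only dissipates the velocities [Y]. *)
Lemma damped_oscillator_cvg0 (R : realType) (k beta : R)
    (X1 Y1 X2 Y2 f g : R -> R) :
  0 < k ->
  (forall t : R, 0 < t -> is_derive t (1 : R) X1 (Y1 t)) ->
  (forall t : R, 0 < t -> is_derive t (1 : R) X2 (Y2 t)) ->
  (forall t : R, 0 < t ->
    is_derive t (1 : R) Y1 (- X1 t - k * Y1 t - beta * Y2 t + f t)) ->
  (forall t : R, 0 < t ->
    is_derive t (1 : R) Y2 (- X2 t - k * Y2 t + beta * Y1 t + g t)) ->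
  f t @[t --> +oo] --> (0 : R) -> g t @[t --> +oo] --> (0 : R) ->
  [/\ X1 t @[t --> +oo] --> (0 : R), Y1 t @[t --> +oo] --> (0 : R),
      X2 t @[t --> +oo] --> (0 : R) & Y2 t @[t --> +oo] --> (0 : R)].
Proof.
move=> k0 dX1 dX2 dY1 dY2 f0 g0.
(* [D] bounds the coefficient of [Y1 ^+ 2 + Y2 ^+ 2] that Young's inequality leaves in the
   derivative of the cross term. With [e * D = k / 4], the cross term costs a quarter of the damping
   [k]; the forcing costs another quarter, and half survives. *)
pose D := 1 + 2 * k ^+ 2 + 2 * beta ^+ 2.
have D1 : 1 <= D by rewrite /D -addrA lerDl; nra.
have D0 : 0 < D by exact: lt_le_trans D1.
pose e := k / (4 * D).
have eD : e * D = k / 4 by rewrite /e; field; rewrite gt_eqF.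
have e0 : 0 < e by rewrite divr_gt0// mulr_gt0.
(* The cross term is at most the energy in absolute value, so [e <= 1 / 2] makes [E] comparable to
   [N]. *)
have e2 : e <= 1 / 2.
  rewrite /e ler_pdivrMr ?mulr_gt0// /D; nra.
pose N t := X1 t ^+ 2 + Y1 t ^+ 2 + X2 t ^+ 2 + Y2 t ^+ 2.
pose E t := (X1 t ^+ 2 + Y1 t ^+ 2 + X2 t ^+ 2 + Y2 t ^+ 2) / 2
  + e * (X1 t * Y1 t + X2 t * Y2 t).
have xy (u v : R) : - (u ^+ 2 + v ^+ 2) / 2 <= u * v <= (u ^+ 2 + v ^+ 2) / 2.
  by have := sqr_ge0 (u - v); have := sqr_ge0 (u + v); rewrite sqrrB sqrrD; lra.
have NE t : N t <= 4 * E t /\ E t <= N t.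
  rewrite /N /E; have /andP[? ?] := xy (X1 t) (Y1 t).
  have /andP[? ?] := xy (X2 t) (Y2 t).
  set S := X1 t * Y1 t + X2 t * Y2 t.
  set M := (X1 t ^+ 2 + Y1 t ^+ 2 + X2 t ^+ 2 + Y2 t ^+ 2) / 2.
  have SM : 0 <= M - S by rewrite /S /M; lra.
  have SpM : 0 <= M + S by rewrite /S /M; lra.
  have := ler_wpM2r SM e2; have := ler_wpM2r SpM e2.
  have := mulr_ge0 (ltW e0) SM; have := mulr_ge0 (ltW e0) SpM.
  have -> : X1 t ^+ 2 + Y1 t ^+ 2 + X2 t ^+ 2 + Y2 t ^+ 2 = 2 * M.
    by rewrite /M; field.
  by move: SM SpM; clear; split; nra.
have N0 t : 0 <= N t by rewrite /N !addr_ge0 ?sqr_ge0.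
have E0 : E t @[t --> +oo] --> (0 : R).
  pose dE t := X1 t * Y1 t + Y1 t * (- X1 t - k * Y1 t - beta * Y2 t + f t)
    + X2 t * Y2 t + Y2 t * (- X2 t - k * Y2 t + beta * Y1 t + g t)
    + e * (Y1 t ^+ 2 + X1 t * (- X1 t - k * Y1 t - beta * Y2 t + f t)
    + Y2 t ^+ 2 + X2 t * (- X2 t - k * Y2 t + beta * Y1 t + g t)).
  pose F t := (1 / k + e) * (f t ^+ 2 + g t ^+ 2).
  apply: (@cvg0_of_dissipation _ E dE F (e / 2)).
  - by rewrite divr_gt0.
  - by move=> t; have [] := NE t; have := N0 t; lra.
  - move=> t t0; have := dX1 t t0; have := dX2 t t0.
    have := dY1 t t0; have := dY2 t t0 => ? ? ? ?.
    by apply: is_derive_eq; rewrite /dE /GRing.scale /=; field.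
  - move=> t t0; have [_ EN] := NE t.
    (* Decay is proved at rate [e / 2] in terms of [N], which suffices because [E <= N]. The [beta]
       terms cancel in the derivative of the energy and survive only in that of the cross term. *)
    apply: (@le_trans _ _ (- (e / 2) * N t + F t)); last by rewrite lerD2r; nra.
    rewrite /N /dE /F.
    set x1 := X1 t; set y1 := Y1 t; set x2 := X2 t; set y2 := Y2 t.
    set a := f t; set b := g t.
    (* Young's inequality for each cross term *)
    have yf (y z : R) : y * z <= k / 4 * y ^+ 2 + 1 / k * z ^+ 2.
      have -> : k / 4 * y ^+ 2 + 1 / k * z ^+ 2 =
          y * z + (k * y / 2 - z) ^+ 2 / k.
        by field; rewrite gt_eqF.
      by rewrite lerDl divr_ge0 ?sqr_ge0 ?ltW.
    have h1 (x y l : R) : x * (l * y) <= x ^+ 2 / 8 + 2 * l ^+ 2 * y ^+ 2.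
      rewrite -subr_ge0.
      have -> : x ^+ 2 / 8 + 2 * l ^+ 2 * y ^+ 2 - x * (l * y) =
        2 * (x / 4 - l * y) ^+ 2 by field.
      by rewrite mulr_ge0// sqr_ge0.
    have h2 (x z : R) : x * z <= x ^+ 2 / 4 + z ^+ 2.
      have := sqr_ge0 (x / 2 - z); rewrite sqrrB; nra.
    have i1 := yf y1 a; have i2 := yf y2 b.
    have j1 := h1 x1 y1 (- k); have j2 := h1 x2 y2 (- k).
    have j3 := h1 x1 y2 (- beta); have j4 := h1 x2 y1 beta.
    have j5 := h2 x1 a; have j6 := h2 x2 b.
    have J : e * (x1 * (- k * y1) + x2 * (- k * y2) + x1 * (- beta * y2)
        + x2 * (beta * y1) + x1 * a + x2 * b + y1 ^+ 2 + y2 ^+ 2) <=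
        e * (x1 ^+ 2 / 2 + x2 ^+ 2 / 2 + a ^+ 2 + b ^+ 2
          + D * (y1 ^+ 2 + y2 ^+ 2)).
      rewrite ler_pM2l// /D; move: j1 j2 j3 j4 j5 j6; rewrite !sqrrN; lra.
    have ek : e <= k / 4 by rewrite -eD ler_peMr// ltW.
    have J' : e * (y1 ^+ 2 + y2 ^+ 2) <= k / 4 * (y1 ^+ 2 + y2 ^+ 2).
      by rewrite ler_wpM2r// addr_ge0// sqr_ge0.
    have JD : e * (x1 ^+ 2 / 2 + x2 ^+ 2 / 2 + a ^+ 2 + b ^+ 2
          + D * (y1 ^+ 2 + y2 ^+ 2)) =
        e * (x1 ^+ 2 / 2 + x2 ^+ 2 / 2 + a ^+ 2 + b ^+ 2)
          + k / 4 * (y1 ^+ 2 + y2 ^+ 2) by rewrite -eD; ring.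
    have ky : 0 <= k * (y1 ^+ 2 + y2 ^+ 2).
      by rewrite mulr_ge0 ?addr_ge0 ?sqr_ge0 ?ltW.
    by move: J; rewrite JD => J; clear - J J' i1 i2 ky; nra.
  - rewrite -[X in _ --> X](mulr0 (1 / k + e)); apply: cvgMl_tmp.
    rewrite -[X in _ --> X](addr0 0) -{1}[0](mul0r 0) -{1}[X in _ + X](mul0r 0).
    by apply: cvgD; rewrite /=; apply: cvgM.
have sq (u : R -> R) : (forall t, u t ^+ 2 <= N t) ->
    u t @[t --> +oo] --> (0 : R).
  move=> uN; apply/cvg0_pinftyP => d d0.
  move/cvg0_pinftyP/(_ (d ^+ 2 / 4)): (E0).
  case=> [|T ET]; first by rewrite divr_gt0// exprn_gt0.
  exists T => t /ET /= /ltr_normlP[_ Et].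
  rewrite -ltr_sqr ?nnegrE ?normr_ge0 ?(ltW d0)// real_normK ?num_real//.
  apply: le_lt_trans (uN t) _; have [] := NE t; lra.
by split; apply: sq => t; rewrite /N; have := sqr_ge0 (X1 t);
  have := sqr_ge0 (Y1 t); have := sqr_ge0 (X2 t); have := sqr_ge0 (Y2 t); lra.
Qed.

(** * The maximum principle on the graph *)

Lemma interconnection_rowsum0 (R : realType) (p : nat) (G : 'M[R]_p) :
  interconnection G -> forall i, \sum_j G i j = 0.
Proof.
by move=> [_ hd] i; rewrite (bigD1 i)//= hd addNr.
Qed.

(** Zero row sums allow the action of [G] to be written with differences, whose signs are known when
    [v i] is maximal. *)
Lemma interconnection_sumB (R : realType) (p : nat) (G : 'M[R]_p)
    (v : 'I_p -> R) (i : 'I_p) :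
  interconnection G -> \sum_j G i j * (v j - v i) = \sum_j G i j * v j.
Proof.
move=> hG; under eq_bigr do rewrite mulrBr.
by rewrite sumrB -mulr_suml interconnection_rowsum0// mul0r subr0.
Qed.

Lemma interconnection_max_le0 (R : realType) (p : nat) (G : 'M[R]_p)
    (v : 'I_p -> R) (i j : 'I_p) :
  interconnection G -> (forall k, v k <= v i) -> G i j * (v j - v i) <= 0.
Proof.
move=> [hp _] vi; have [<-|ij] := eqVneq i j; first by rewrite subrr mulr0.
by rewrite mulr_ge0_le0 ?hp// subr_le0.
Qed.

Lemma exists_argmax (R : realType) (p : nat) (v : 'I_p -> R) (r : 'I_p) :
  exists i, forall j, v j <= v i.
Proof.
have [i _ vi] := @Order.TotalTheory.arg_maxP _ _ _ r xpredT v isT.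
by exists i => j; exact: vi.
Qed.

(** At a maximal node a sum of nonpositive terms is zero, so each term is zero and every
    out-neighbour is again maximal; induction along the path carries the maximum to [r]. *)
Lemma interconnection_max_connect (R : realType) (p : nat) (G : 'M[R]_p)
    (v : 'I_p -> R) (i r : 'I_p) :
  interconnection G -> (forall k, \sum_j G k j * v j = 0) ->
  (forall k, v k <= v i) -> connect (interconnection_graph G) i r -> v r = v i.
Proof.
move=> hG hv vi /connectP[s]; elim: s i vi => [|k s IH] i vi /=.
  by move=> _ ->.
move=> /andP[ik ps] rE.
have /eqP : \sum_j - (G i j * (v j - v i)) = 0.
  by rewrite sumrN interconnection_sumB// hv oppr0.
rewrite psumr_eq0; last by move=> j _; rewrite oppr_ge0 interconnection_max_le0.
move=> /allP/(_ k (mem_index_enum _)); rewrite /= oppr_eq0 mulf_eq0.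
rewrite (gt_eqF ik)/= subr_eq0 => /eqP vki.
by rewrite -vki; apply: IH => // j; rewrite vki.
Qed.

(** Evaluation at a maximum of [v] gives [c <= 0], and the same for [- v] gives [0 <= c]. The node
    [r] makes the index set nonempty. *)
Lemma interconnection_image_const (R : realType) (p : nat) (G : 'M[R]_p)
    (v : 'I_p -> R) (c : R) (r : 'I_p) :
  interconnection G -> (forall i, \sum_j G i j * v j = c) -> c = 0.
Proof.
move=> hG.
have le0 (u : 'I_p -> R) d : (forall i, \sum_j G i j * u j = d) -> d <= 0.
  move=> hu; have [i ui] := exists_argmax u r.
  rewrite -(hu i) -interconnection_sumB//.
  by apply: sumr_le0 => j _; exact: interconnection_max_le0.
move=> hv; apply/eqP; rewrite eq_le (le0 v)//= -oppr_le0.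
apply: (le0 (fun i => - v i)) => i.
by under eq_bigr do rewrite mulrN; rewrite sumrN hv.
Qed.

(** A maximal node reaches [r], so [v r] is the maximum; applied to [- v], the same argument makes
    it the minimum. *)
Lemma interconnection_ker_const (R : realType) (p : nat) (G : 'M[R]_p)
    (v : 'I_p -> R) (r : 'I_p) :
  interconnection G ->
  (forall j, j != r -> connect (interconnection_graph G) j r) ->
  (forall i, \sum_j G i j * v j = 0) -> forall i, v i = v r.
Proof.
move=> hG hr.
have ler (u : 'I_p -> R) : (forall i, \sum_j G i j * u j = 0) ->
    forall i, u i <= u r.
  move=> hu j; have [i ui] := exists_argmax u r.
  rewrite (interconnection_max_connect (r := r) hG hu ui)//.
  by have [->|/hr//] := eqVneq i r; exact: connect0.
move=> hv i; apply/eqP; rewrite eq_le ler//= -lerN2.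
apply: (ler (fun i => - v i)) => k.
by under eq_bigr do rewrite mulrN; rewrite sumrN hv oppr0.
Qed.

(** * Nonzero complex eigenvalues of an interconnection *)

Lemma Re_sum (R : realType) (I : Type) (s : seq I) (P : pred I)
    (F : I -> R[i]) :
  complex.Re (\sum_(i <- s | P i) F i) = \sum_(i <- s | P i) complex.Re (F i).
Proof. by apply: (big_morph _ (id1 := 0)) => // -[? ?] [? ?]. Qed.

Lemma Im_sum (R : realType) (I : Type) (s : seq I) (P : pred I)
    (F : I -> R[i]) :
  complex.Im (\sum_(i <- s | P i) F i) = \sum_(i <- s | P i) complex.Im (F i).
Proof. by apply: (big_morph _ (id1 := 0)) => // -[? ?] [? ?]. Qed.

Lemma Re_mulmx_real (R : realType) (m n q : nat) (A : 'M[R]_(m, n))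
    (B : 'M[R[i]]_(n, q)) :
  map_mx (@complex.Re R) (map_mx (real_complex R) A *m B) =
  A *m map_mx (@complex.Re R) B.
Proof.
apply/matrixP => i j; rewrite !mxE Re_sum; apply: eq_bigr => k _.
by rewrite !mxE; case: (B k j) => a b; simpc.
Qed.

Lemma Im_mulmx_real (R : realType) (m n q : nat) (A : 'M[R]_(m, n))
    (B : 'M[R[i]]_(n, q)) :
  map_mx (@complex.Im R) (map_mx (real_complex R) A *m B) =
  A *m map_mx (@complex.Im R) B.
Proof.
apply/matrixP => i j; rewrite !mxE Im_sum; apply: eq_bigr => k _.
by rewrite !mxE; case: (B k j) => a b; simpc.
Qed.

Lemma Re_mulmx_realr (R : realType) (m n q : nat) (A : 'M[R[i]]_(m, n))
    (B : 'M[R]_(n, q)) :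
  map_mx (@complex.Re R) (A *m map_mx (real_complex R) B) =
  map_mx (@complex.Re R) A *m B.
Proof.
apply/matrixP => i j; rewrite !mxE Re_sum; apply: eq_bigr => k _.
by rewrite !mxE; case: (A i k) => a b; simpc.
Qed.

Lemma Im_mulmx_realr (R : realType) (m n q : nat) (A : 'M[R[i]]_(m, n))
    (B : 'M[R]_(n, q)) :
  map_mx (@complex.Im R) (A *m map_mx (real_complex R) B) =
  map_mx (@complex.Im R) A *m B.
Proof.
apply/matrixP => i j; rewrite !mxE Im_sum; apply: eq_bigr => k _.
by rewrite !mxE; case: (A i k) => a b; simpc.
Qed.

(** [eigenvalue] refers to row eigenvectors, while the maximum principle concerns column vectors. *)
Lemma eigenvalue_tr (F : fieldType) (n : nat) (A : 'M[F]_n) (a : F) :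
  eigenvalue A^T a = eigenvalue A a.
Proof.
rewrite !eigenvalue_root_char; congr (root _ a).
rewrite /char_poly -det_tr; congr (\det _).
by apply/matrixP => i j; rewrite !mxE eq_sym.
Qed.

(* Maximum principle for [|v i| ^ 2]: at a maximal entry the real part of
   [conj (v i) * (G v) i] is a sum of nonpositive terms. *)
Lemma interconnection_eigenvalue (R : realType) (p : nat) (G : 'M[R]_p)
    (z : R[i]) :
  interconnection G -> eigenvalue (map_mx (real_complex R) G) z ->
  z != 0 -> complex.Re z < 0.
Proof.
move=> hG; rewrite -eigenvalue_tr => /eigenvalueP[v].
move/(congr1 trmx); rewrite trmx_mul trmxK linearZ /= => hv v0 z0.
pose a i := complex.Re (v 0 i); pose b i := complex.Im (v 0 i).
pose m i := a i ^+ 2 + b i ^+ 2.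
have [r vr0] : exists r, v 0 r != 0.
  apply/existsP; apply: contraNT v0; rewrite negb_exists => /forallP v0.
  by apply/eqP/rowP => i; rewrite mxE; apply/eqP; rewrite -[_ == _]negbK v0.
have [i mi] := exists_argmax m r.
have mi0 : 0 < m i.
  apply: lt_le_trans (mi r); rewrite lt_neqAle /m addr_ge0 ?sqr_ge0// andbT.
  apply: contra vr0; rewrite eq_sym paddr_eq0 ?sqr_ge0// !sqrf_eq0.
  by rewrite /a /b eq_complex.
have ha : \sum_j G i j * a j = complex.Re z * a i - complex.Im z * b i.
  have := congr1 (fun M => map_mx (@complex.Re R) M i 0) hv.
  rewrite Re_mulmx_real !mxE; under eq_bigr do rewrite !mxE; move=> ->.
  by rewrite /a /b; case: (z) (v 0 i) => [? ?] [? ?]; simpc.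
have hb : \sum_j G i j * b j = complex.Im z * a i + complex.Re z * b i.
  have := congr1 (fun M => map_mx (@complex.Im R) M i 0) hv.
  rewrite Im_mulmx_real !mxE; under eq_bigr do rewrite !mxE; move=> ->.
  by rewrite /a /b; case: (z) (v 0 i) => [? ?] [? ?]; simpc; rewrite /= addrC.
rewrite -interconnection_sumB// in ha; rewrite -interconnection_sumB// in hb.
(* [d j] is the squared modulus of [v j - v i]. Twice the real part of [conj (v i) * (v j - v i)]
   equals [m j - m i - d j]. *)
pose d j := (a j - a i) ^+ 2 + (b j - b i) ^+ 2.
have key : \sum_j (G i j * (m j - m i) - G i j * d j) =
    2 * (complex.Re z * m i).
  have -> : 2 * (complex.Re z * m i) =
      2 * a i * (complex.Re z * a i - complex.Im z * b i)
      + 2 * b i * (complex.Im z * a i + complex.Re z * b i) by rewrite /m; ring.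
  rewrite -ha -hb !mulr_sumr -big_split /=; apply: eq_bigr => j _.
  by rewrite /m /d; ring.
have d0 j : 0 <= d j by rewrite addr_ge0 ?sqr_ge0.
have Gd j : 0 <= G i j * d j.
  have [<-|ij] := eqVneq i j; first by rewrite /d !subrr expr0n addr0 mulr0.
  by rewrite mulr_ge0//; apply: hG.1.
have Gm j : G i j * (m j - m i) <= 0 by exact: interconnection_max_le0.
have Re0 : complex.Re z <= 0.
  rewrite -(pmulr_lle0 _ mi0) -(pmulr_rle0 _ (ltr0n R 2)) -key.
  by apply: sumr_le0 => j _; rewrite subr_le0; exact: le_trans (Gm j) (Gd j).
(* If [z] were purely imaginary, every term of the sum would vanish, hence [z * v i = 0] with [z]
   nonzero, against [0 < m i]. *)
rewrite lt_neqAle Re0 andbT; apply/eqP => z1.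
have Gd0 j : G i j * d j = 0.
  have /eqP : \sum_j (- (G i j * (m j - m i)) + G i j * d j) = 0.
    under eq_bigr do rewrite addrC -opprB.
    by rewrite sumrN key z1 mul0r mulr0 oppr0.
  rewrite psumr_eq0; last by move=> k _; rewrite addr_ge0// oppr_ge0.
  move=> /allP/(_ j (mem_index_enum _)); rewrite /= paddr_eq0 ?oppr_ge0//.
  by move=> /andP[_ /eqP].
have G0 j : G i j * (a j - a i) = 0 /\ G i j * (b j - b i) = 0.
  move/eqP: (Gd0 j); rewrite mulf_eq0 => /orP[/eqP->|]; first by rewrite !mul0r.
  rewrite /d paddr_eq0 ?sqr_ge0// !sqrf_eq0 => /andP[/eqP-> /eqP->].
  by rewrite !mulr0.
have /negbTE Imz : complex.Im z != 0.
  by apply: contra z0; rewrite eq_complex /= z1 eqxx.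
move: ha hb; rewrite !big1; try by [move=> j _; case: (G0 j)].
rewrite z1 !mul0r sub0r addr0 => /esym/eqP + /esym/eqP.
rewrite oppr_eq0 !mulf_eq0 Imz /= => /eqP bi /eqP ai.
by move: mi0; rewrite /m ai bi expr0n addr0 ltxx.
Qed.

(** * Complex kernel and annihilating products *)

Lemma interconnection_complex_ker_const (R : realType) (p : nat)
    (G : 'M[R]_p) (v : 'cV[R[i]]_p) (r : 'I_p) :
  interconnection G ->
  (forall j, j != r -> connect (interconnection_graph G) j r) ->
  map_mx (real_complex R) G *m v = 0 -> v = const_mx (v r 0).
Proof.
move=> hG hr hv; apply/colP => i; rewrite mxE.
have hR := interconnection_ker_const (v := fun j => complex.Re (v j 0)) hG hr.
have hI := interconnection_ker_const (v := fun j => complex.Im (v j 0)) hG hr.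
apply/eqP; rewrite eq_complex; apply/andP; split; apply/eqP;
  [apply: hR|apply: hI] => k.
- have := congr1 (fun M => map_mx (@complex.Re R) M k 0) hv.
  by rewrite Re_mulmx_real !mxE; under eq_bigr do rewrite mxE.
- have := congr1 (fun M => map_mx (@complex.Im R) M k 0) hv.
  by rewrite Im_mulmx_real !mxE; under eq_bigr do rewrite mxE.
Qed.

(** Each column of [GC *m B] lies in the kernel, hence is constant; a constant vector in the image
    of [G] is zero, by the real and imaginary parts separately. *)
Lemma interconnection_ker_sqr (R : realType) (p n : nat) (G : 'M[R]_p)
    (B : 'M[R[i]]_(p, n)) (r : 'I_p) :
  interconnection G ->
  (forall j, j != r -> connect (interconnection_graph G) j r) ->
  let GC := map_mx (real_complex R) G in
  GC *m (GC *m B) = 0 -> GC *m B = 0.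
Proof.
move=> hG hr GC hB; apply/matrixP => i j; rewrite [RHS]mxE.
have hc : GC *m col j B = const_mx ((GC *m col j B) r 0).
  apply: (interconnection_complex_ker_const hG hr).
  by rewrite colE !mulmxA -[_ *m GC *m B]mulmxA hB mul0mx.
have -> : (GC *m B) i j = (GC *m col j B) i 0.
  by rewrite colE mulmxA -colE [RHS]mxE.
rewrite hc mxE; set c := _ r 0 in hc *.
apply/eqP; rewrite eq_complex /=; apply/andP; split; apply/eqP.
- apply: (@interconnection_image_const _ _ _
    (fun k => complex.Re (B k j)) _ r hG).
  move=> k; have := congr1 (fun M => map_mx (@complex.Re R) M k 0) hc.
  by rewrite Re_mulmx_real !mxE; under eq_bigr do rewrite !mxE.
- apply: (@interconnection_image_const _ _ _
    (fun k => complex.Im (B k j)) _ r hG).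
  move=> k; have := congr1 (fun M => map_mx (@complex.Im R) M k 0) hc.
  by rewrite Im_mulmx_real !mxE; under eq_bigr do rewrite !mxE.
Qed.

(* All but one of the zero factors in Cayley-Hamilton can be dropped, since
   [ker G^2 = ker G]. *)
Lemma interconnection_annihilator (R : realType) (n : nat) (G : 'M[R]_n.+1)
    (r : 'I_n.+1) :
  interconnection G ->
  (forall j, j != r -> connect (interconnection_graph G) j r) ->
  let GC := map_mx (real_complex R) G in
  exists s : seq R[i], (forall z, z \in s -> complex.Re z < 0) /\
    GC *m horner_mx GC (\prod_(z <- s) ('X - z%:P)) = 0.
Proof.
move=> hG hr GC.
have [s hs] := closed_field_poly_normal (char_poly GC).
rewrite (monicP (char_poly_monic _)) scale1r in hs.
exists [seq z <- s | z != 0]; split=> [z|].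
  rewrite mem_filter => /andP[z0 zs].
  apply: (interconnection_eigenvalue hG) => //.
  by rewrite eigenvalue_root_char -/GC hs root_prod_XsubC.
rewrite big_filter; set q := \prod_(z <- s | _) _.
have [k hk] : exists k,
    \prod_(z <- s | z == 0) ('X - z%:P) = 'X^k :> {poly R[i]}.
  exists (count (fun z => z == 0) s).
  rewrite (eq_bigr (fun=> 'X)); last by move=> z /eqP->; rewrite subr0.
  rewrite big_const_seq.
  by elim: (count _ _) => [|m IH]; rewrite ?expr0 //= IH exprS.
have : horner_mx GC ('X^k * q) = 0.
  by rewrite -(Cayley_Hamilton GC) hs (bigID (fun z => z == 0)) /= hk.
(* With no factor ['X], the product [q] already annihilates; with one, this is the goal; from two
   on, one factor is dropped by [interconnection_ker_sqr]. *)
elim: k {hk} => [|k IH]; first by rewrite expr0 mul1r => ->; rewrite mulmx0.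
rewrite exprS -mulrA rmorphM /= horner_mx_X.
case: k IH => [|k] IH; first by rewrite expr0 mul1r.
move=> h; apply: IH; move: h; rewrite exprS -mulrA rmorphM /= horner_mx_X.
exact: (interconnection_ker_sqr hG hr).
Qed.

Lemma interconnection_annihilator_sum0 (R : realType) (n : nat)
    (G : 'M[R]_n.+1) (r : 'I_n.+1) :
  interconnection G ->
  (forall j, j != r -> connect (interconnection_graph G) j r) ->
  let GC := map_mx (real_complex R) G in
  exists s : seq R[i], (forall z, z \in s -> complex.Re z < 0) /\
    forall w : 'rV_n.+1, \sum_j w 0 j = 0 ->
      w *m horner_mx GC (\prod_(z <- s) ('X - z%:P)) = 0.
Proof.
move=> hG hr GC; have [s [s0 hs]] := interconnection_annihilator hG hr.
exists s; split => // w w0.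
set B := horner_mx _ _ in hs *.
apply/rowP => k; rewrite !mxE.
have Bk : col k B = const_mx (B r k).
  have -> : B r k = (col k B) r 0 by rewrite mxE.
  apply: (interconnection_complex_ker_const hG hr).
  by rewrite colE mulmxA -/GC hs mul0mx.
have BE j : B j k = B r k.
  by have := congr1 (fun M : 'cV_n.+1 => M j 0) Bk; rewrite !mxE.
under eq_bigr do rewrite BE.
by rewrite -mulr_suml w0 mul0r.
Qed.

(** * Weighted sums of the oscillators *)

Definition pairing (R : realType) (p : nat) (a : 'rV[R]_p) (x : 'I_p -> R -> R)
    (t : R) : R := \sum_(j < p) a 0 j * x j t.

(** Convergence of the complex sums w.x and w.y to 0, split into real and imaginary parts so that
    only real functions are differentiated. *)
Definition vanishing (R : realType) (p : nat) (x y : 'I_p -> R -> R)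
    (w : 'rV[R[i]]_p) : Prop :=
  let a := map_mx (@complex.Re R) w in let b := map_mx (@complex.Im R) w in
  [/\ pairing a x t @[t --> +oo] --> (0 : R),
      pairing a y t @[t --> +oo] --> (0 : R),
      pairing b x t @[t --> +oo] --> (0 : R) &
      pairing b y t @[t --> +oo] --> (0 : R)].

Lemma is_derive_pairing (R : realType) (p : nat) (a : 'rV[R]_p)
    (x dx : 'I_p -> R -> R) (t : R) :
  (forall j, is_derive t (1 : R) (x j) (dx j t)) ->
  is_derive t (1 : R) (pairing a x) (pairing a dx t).
Proof.
move=> hx.
have -> : pairing a x = \sum_(j < p) (a 0 j *: x j).
  by apply/funext => s; rewrite /pairing fct_sumE.
by apply: is_derive_sum => j; exact: is_deriveZ.
Qed.

Lemma oscillators_derive (R : realType) (p : nat) (G : 'M[R]_p)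
    (x0 y0 : 'I_p -> R) (x y : 'I_p -> R -> R) (a : 'rV[R]_p) (t : R) :
  interconnection G -> oscillators_solution G x0 y0 x y -> 0 < t ->
  is_derive t (1 : R) (pairing a x) (pairing a y t) /\
  is_derive t (1 : R) (pairing a y) (- pairing a x t + pairing (a *m G) y t).
Proof.
move=> hG hsol t0; split.
  by apply: is_derive_pairing => j; have [_ _ _ /(_ t t0)] := hsol j.
(* Exchanging the two sums moves [G] from the velocities to the weights. *)
pose dy j s := - x j s + \sum_(k < p) G j k * (y k s - y j s).
have -> : - pairing a x t + pairing (a *m G) y t = pairing a dy t.
  rewrite /pairing -sumrN.
  under [X in _ + X]eq_bigr do rewrite mxE mulr_suml.
  rewrite exchange_big -big_split /=; apply: eq_bigr => j _.
  rewrite /dy (interconnection_sumB (fun k => y k t))// mulrDr mulrN mulr_sumr.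
  by congr (_ + _); apply: eq_bigr => k _; rewrite mulrA.
by apply: is_derive_pairing => j; have [_ _ _ _ /(_ t t0)] := hsol j.
Qed.

(** The real and imaginary parts of [w G = z w + u] give a pair of oscillators with damping [- Re z]
    and cross coupling [Im z], forced by u.y. *)
Lemma vanishing_of_shift (R : realType) (p : nat) (G : 'M[R]_p)
    (x0 y0 : 'I_p -> R) (x y : 'I_p -> R -> R) (w : 'rV[R[i]]_p) (z : R[i]) :
  interconnection G -> oscillators_solution G x0 y0 x y ->
  complex.Re z < 0 ->
  vanishing x y (w *m (map_mx (real_complex R) G - z%:M)) ->
  vanishing x y w.
Proof.
move=> hG hsol z0 [].
set u := w *m _; set c := map_mx _ u; set d := map_mx _ u => _ hc _ hd.
rewrite /vanishing; set a := map_mx _ w; set b := map_mx _ w => /=.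
have hu : w *m map_mx (real_complex R) G = z *: w + u.
  by rewrite /u mulmxBr mul_mx_scalar addrC subrK.
have ha t : pairing (a *m G) y t = complex.Re z * pairing a y t
    - complex.Im z * pairing b y t + pairing c y t.
  rewrite /a -Re_mulmx_realr hu /pairing !mulr_sumr -sumrB -big_split /=.
  apply: eq_bigr => j _; rewrite !mxE.
  by case: (z) (w 0 j) (\sum__ _) => [? ?] [? ?] [? ?] /=; ring.
have hb t : pairing (b *m G) y t = complex.Re z * pairing b y t
    + complex.Im z * pairing a y t + pairing d y t.
  rewrite /b -Im_mulmx_realr hu /pairing !mulr_sumr -!big_split /=.
  apply: eq_bigr => j _; rewrite !mxE.
  by case: (z) (w 0 j) (\sum__ _) => [? ?] [? ?] [? ?] /=; ring.
apply: (@damped_oscillator_cvg0 _ (- complex.Re z) (complex.Im z)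
  (pairing a x) (pairing a y) (pairing b x) (pairing b y)
  (pairing c y) (pairing d y) _ _ _ _ _ hc hd).
- by rewrite oppr_gt0.
- by move=> t t0; have [] := oscillators_derive a hG hsol t0.
- by move=> t t0; have [] := oscillators_derive b hG hsol t0.
- move=> t t0; have [_] := oscillators_derive a hG hsol t0.
  by rewrite ha => dY; apply: (is_derive_eq dY); ring.
- move=> t t0; have [_] := oscillators_derive b hG hsol t0.
  by rewrite hb => dY; apply: (is_derive_eq dY); ring.
Qed.

Lemma vanishing_sum0 (R : realType) (n : nat) (G : 'M[R]_n.+1)
    (x0 y0 : 'I_n.+1 -> R) (x y : 'I_n.+1 -> R -> R) (w : 'rV[R[i]]_n.+1)
    (r : 'I_n.+1) :
  interconnection G ->
  (forall j, j != r -> connect (interconnection_graph G) j r) ->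
  oscillators_solution G x0 y0 x y ->
  \sum_j w 0 j = 0 -> vanishing x y w.
Proof.
move=> hG hr hsol w0.
have [s [s0 hs]] := interconnection_annihilator_sum0 hG hr.
have {hs w0} := hs w w0.
(* The zero-sum condition has been traded for annihilation by the product, a property that passes
   from [w] to [w (G - z)] with one factor fewer; hence the induction over all [w]. *)
elim: s s0 w => [|z s IH] s0 w.
  rewrite big_nil rmorph1 mulmx1 => ->; rewrite /vanishing.
  have h0 (f : 'I_n.+1 -> R -> R) (a : 'rV[R]_n.+1) : a = 0 ->
      pairing a f t @[t --> +oo] --> (0 : R).
    move=> ->; have -> : pairing 0 f = cst 0; last exact: cvg_cst.
    by apply/funext => t; rewrite /pairing big1// => j _; rewrite mxE mul0r.
  by split; apply: h0; apply/rowP => j; rewrite !mxE.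
rewrite big_cons rmorphM rmorphB /= horner_mx_X horner_mx_C mulmxA => hw.
apply: (vanishing_of_shift hG hsol (s0 z (mem_head _ _))).
by apply: IH hw => z' z's; apply: s0; rewrite inE z's orbT.
Qed.

Theorem corollary1 (R : realType) (p : nat) (G : 'M[R]_p)
    (hG : interconnection G) (hconn : connected_interconnection G)
    (x0 y0 : 'I_p -> R) (x y : 'I_p -> R -> R)
    (hsol : oscillators_solution G x0 y0 x y) :
  synchronize (oscillator_state x y).
Proof.
case: hconn => r hr.
case: p G hG x0 y0 x y hsol r hr => [|n] G hG x0 y0 x y hsol r hr.
  by case: (r).
(* The trajectory of the root [r] is the common limit; the weight [delta_mx 0 i - delta_mx 0 r] has
   zero sum and pairs to the difference of the two oscillators. *)
exists (oscillator_state x y r) => i.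
have [|hx hy _ _] :=
    vanishing_sum0 (w := delta_mx 0 i - delta_mx 0 r) hG hr hsol.
  under eq_bigr do rewrite !mxE eqxx /= !mulrb.
  by rewrite sumrB -!big_mkcond /= !big_pred1_eq subrr.
have pE (f : 'I_n.+1 -> R -> R) :
    pairing (map_mx (@complex.Re R) (delta_mx 0 i - delta_mx 0 r)) f =
    fun t => f i t - f r t.
  apply/funext => t; rewrite /pairing.
  rewrite (eq_bigr (fun j => (if j == i then f j t else 0)
    - (if j == r then f j t else 0))).
    by rewrite sumrB -!big_mkcond /= !big_pred1_eq.
  move=> j _; rewrite !mxE eqxx /=.
  by case: (j == i); case: (j == r) => /=; ring.
rewrite pE in hx; rewrite pE in hy.
have -> : (fun t => euclid_norm
      (oscillator_state x y i t - oscillator_state x y r t)) =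
    Num.sqrt \o (fun t => (x i t - x r t) ^+ 2 + (y i t - y r t) ^+ 2).
  apply/funext => t.
  by rewrite /euclid_norm !big_ord_recl big_ord0 addr0 !mxE.
have sq0 : (x i t - x r t) ^+ 2 + (y i t - y r t) ^+ 2
    @[t --> +oo] --> (0 : R).
  rewrite -[X in _ --> X](addr0 0) -{1}[0](mul0r 0) -{1}[X in _ + X](mul0r 0).
  by apply: cvgD; rewrite /=; apply: cvgM.
rewrite -[X in _ --> X]sqrtr0.
by apply: (cvg_comp _ _ sq0); exact: sqrt_continuous.
Qed.
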